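(* Let $\mathcal{O}_2(\mathbb{R}^2)$ denote the set of all ordered pairs $(A_1,A_2)$ of real $2 \times 2$ matrices, with the topology given by identifying it with $\mathbf{M}_2(\mathbb{R}) \oplus \mathbf{M}_2(\mathbb{R})$. There exists a nonempty open set $\mathcal{V} \subset \mathcal{O}_2(\mathbb{R}^2)$ such that the sets $$\mathcal{V}_1 := \{(A_1,A_2) \in \mathcal{V} : \{A_1,A_2\} \text{ has a unique Barabanov norm}\}$$ and $$\mathcal{V}_2 := \{(A_1,A_2) \in \mathcal{V} : \{A_1,A_2\} \text{ does not have a unique Barabanov norm}\}$$ are both dense in $\mathcal{V}$.
   Context: $\mathbf{M}_2(\mathbb{R})$ is the space of real $2 \times 2$ matrices with its usual topology as a finite-dimensional normed vector space, and $\|\cdot\|$ denotes the operator norm induced by the Euclidean norm. For a bounded nonempty set $\mathcal{A} \subset \mathbf{M}_2(\mathbb{R})$, the joint spectral radius is $\varrho(\mathcal{A}) := \lim_{n\to\infty} \sup\{\|A_{i_n} \cdots A_{i_1}\|^{1/n} : A_{i_1},\ldots,A_{i_n} \in \mathcal{A}\}$; this limit exists and is independent of the norm used. A Barabanov norm for $\mathcal{A}$ is a norm $|\!|\!|\cdot|\!|\!|$ on $\mathbb{R}^2$ such that $\varrho(\mathcal{A})\,|\!|\!|v|\!|\!| = \sup\{|\!|\!|Av|\!|\!| : A \in \mathcal{A}\}$ for every $v \in \mathbb{R}^2$. $\mathcal{A}$ is said to have a unique Barabanov norm if it has at least one Barabanov norm and any two Barabanov norms for $\mathcal{A}$ are equal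 up to multiplication by a positive scalar constant. *)

(* Defs.v *)
From mathcomp Require Import all_boot all_order all_algebra.
From mathcomp Require Import all_classical all_reals all_analysis.
Import Order.TTheory GRing.Theory Num.Theory.
Import numFieldNormedType.Exports.

Set Implicit Arguments.
Unset Strict Implicit.
Unset Printing Implicit Defensive.

Local Open Scope classical_set_scope.
Local Open Scope ring_scope.

Definition euclidean_norm (R : realType) (v : 'cV[R]_2) : R :=
  Num.sqrt (\sum_(i < 2) v i 0 ^+ 2).

(* The norm that the library puts on matrices is the entrywise maximum, so the
   operator norm has to be introduced separately; the library's topology on
   ['M[R]_2] is the usual one. *)
Definition operator_norm (R : realType) (A : 'M[R]_2) : R :=
  sup [set euclidean_norm (A *m v) | v in [set v | euclidean_norm v = 1]].

(* [A_{i_n} ... A_{i_1}] for [M = (A_{i_1}, ..., A_{i_n})]. *)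
Definition word_product (R : realType) (n : nat) (M : 'I_n -> 'M[R]_2) :
    'M[R]_2 :=
  \prod_(i < n) M (rev_ord i).

(* [sup] is the real-valued supremum and [limn] a total operator: this is the
   joint spectral radius when [A] is nonempty and bounded. *)
Definition joint_spectral_radius (R : realType) (A : set 'M[R]_2) : R :=
  limn (fun n : nat =>
    sup [set operator_norm (word_product M) `^ (n%:R)^-1 |
         M in [set M : 'I_n -> 'M[R]_2 | forall i, A (M i)]]).

Definition is_norm (R : realType) (N : 'cV[R]_2 -> R) : Prop :=
  [/\ forall v, 0 <= N v,
      forall v, N v = 0 -> v = 0,
      forall (a : R) v, N (a *: v) = `|a| * N v
    & forall v w, N (v + w) <= N v + N w].

Definition barabanov_norm (R : realType) (A : set 'M[R]_2)
    (N : 'cV[R]_2 -> R) : Prop :=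
  is_norm N /\
  forall v, joint_spectral_radius A * N v = sup [set N (B *m v) | B in A].

Definition has_unique_barabanov_norm (R : realType) (A : set 'M[R]_2) : Prop :=
  (exists N, barabanov_norm A N) /\
  forall N1 N2, barabanov_norm A N1 -> barabanov_norm A N2 ->
    exists2 c : R, 0 < c & forall v, N1 v = c * N2 v.

(* Relative density: unlike the library's [dense], which is density in the
   whole space. *)
Definition dense_in (T : topologicalType) (S V : set T) : Prop :=
  S `<=` V /\ V `<=` closure S.

(* Main.v *)
(* Suppose that [A1] has non-real eigenvalues [r e^(+-it)] and that [A2] is small.
   Then [A1 = r (cos t + sin t J)] with [J^2 = -1], the joint spectral radius is
   [r], and a norm [N] is Barabanov as soon as [A1 / r] preserves [N] and
   [N (A2 v) <= r N v]; one such norm is the Euclidean norm [gauge J] invariant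
   under [J].  Conversely [A1 / r] is a contraction for every Barabanov norm.  If
   [t / pi] is irrational, the powers of [A1 / r] accumulate on every rotation
   [cos s + sin s J], so that a Barabanov norm is invariant under all of them and
   is a multiple of [gauge J].  If [t / pi] is rational, then [A1 / r] has finite
   order up to sign, and averaging a seminorm over its orbit yields an invariant
   norm which is not Euclidean.  Both kinds of angles are dense, and moving [t]
   preserves [J] and [r]. *)

Require Import Defs.
From mathcomp Require Import all_boot all_order all_algebra.
From mathcomp Require Import all_classical all_reals all_analysis.
From mathcomp Require Import ring lra.
Import Order.TTheory GRing.Theory Num.Theory.
Import numFieldNormedType.Exports.

Set Implicit Arguments.
Unset Strict Implicit.
Unset Printing Implicit Defensive.

Local Open Scope classical_set_scope.
Local Open Scope ring_scope.

(** * Complex structures on the plane and their invariant quadratic forms *)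

Section ComplexStructure.
Variable R : realType.
Implicit Types (A B J : 'M[R]_2) (v w : 'cV[R]_2) (s t : R).

Lemma col2P v w : v 0 0 = w 0 0 -> v 1 0 = w 1 0 -> v = w.
Proof.
move=> h0 h1; apply/matrixP => i j; rewrite ord1.
have [->|->] : i = 0 \/ i = 1 by case: i => -[|[|//]] h; [left|right]; exact/val_inj.
  exact: h0.
exact: h1.
Qed.

Lemma mat2P A B : A 0 0 = B 0 0 -> A 0 1 = B 0 1 -> A 1 0 = B 1 0 ->
  A 1 1 = B 1 1 -> A = B.
Proof.
have o2 (i : 'I_2) : i = 0 \/ i = 1.
  by case: i => -[|[|//]] h; [left|right]; exact/val_inj.
move=> h00 h01 h10 h11; apply/matrixP => i j.
by have [->|->] := o2 i; have [->|->] := o2 j.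
Qed.

Lemma mulmx_col2 A v i : (A *m v) i 0 = A i 0 * v 0 0 + A i 1 * v 1 0.
Proof.
by rewrite mxE big_ord_recl big_ord1; congr (_ + A i _ * v _ _); exact/val_inj.
Qed.

Lemma mulmx2E A B i j : (A *m B) i j = A i 0 * B 0 j + A i 1 * B 1 j.
Proof.
by rewrite mxE big_ord_recl big_ord1; congr (_ + A i _ * B _ _); exact/val_inj.
Qed.

(** The sign condition selects one of [J] and [- J], the one for which [qform J] is positive
    definite. *)
Definition complex_structure J := J *m J = - 1%:M /\ 0 < J 1 0.

Lemma complex_structureE J : complex_structure J ->
  [/\ J 1 1 = - J 0 0, J 0 1 * J 1 0 = - (1 + J 0 0 ^+ 2) & 0 < J 1 0].
Proof.
move=> [JJ J0]; split=> //.
  have /(congr1 (fun A : 'M[R]_2 => A 1 0)) := JJ.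
  rewrite /= mulmx2E !mxE /= mulr0n oppr0 => h.
  apply: (@mulfI _ (J 1 0)); first by rewrite gt_eqF.
  by rewrite mulrN; apply/eqP; rewrite -addr_eq0 addrC -[X in _ == X]h; apply/eqP; ring.
have /(congr1 (fun A : 'M[R]_2 => A 0 0)) := JJ.
rewrite /= mulmx2E !mxE /= mulr1n => h.
by rewrite opprD -h; ring.
Qed.

Definition rotation J t : 'M[R]_2 := (cos t)%:M + sin t *: J.

Lemma rotationE J t v i : (rotation J t *m v) i 0 = cos t * v i 0 + sin t * (J *m v) i 0.
Proof. by rewrite mulmxDl mul_scalar_mx -scalemxAl !mxE. Qed.

Lemma rotationD J s t : complex_structure J -> rotation J (s + t) = rotation J s *m rotation J t.
Proof.
move=> [JJ _]; rewrite /rotation mulmxDl !mulmxDr !mul_scalar_mx mul_mx_scalar.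
rewrite -!scalemxAl -!scalemxAr JJ sinD cosD.
apply/matrixP => i j; rewrite !mxE; case: (i == j); rewrite ?mulr1n ?mulr0n /=; ring.
Qed.

(* The determinant of the matrix with columns [v] and [J *m v]. *)
Definition qform J v : R :=
  J 1 0 * v 0 0 ^+ 2 - 2 * J 0 0 * v 0 0 * v 1 0 - J 0 1 * v 1 0 ^+ 2.

Definition gauge J v : R := Num.sqrt (qform J v).

(** Completing the square: the coefficient of [v 1 0 ^+ 2] becomes 1 because [J] has determinant 1.
    Positivity and definiteness of the form follow. *)
Lemma qform_sos J v : complex_structure J ->
  J 1 0 * qform J v = (J 1 0 * v 0 0 - J 0 0 * v 1 0) ^+ 2 + v 1 0 ^+ 2.
Proof.
move=> /complex_structureE[_ h1 _]; rewrite /qform.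
transitivity (J 1 0 ^+ 2 * v 0 0 ^+ 2 - 2 * J 0 0 * J 1 0 * v 0 0 * v 1 0
  - (J 0 1 * J 1 0) * v 1 0 ^+ 2); first by ring.
by rewrite h1; ring.
Qed.

Lemma qform_ge0 J v : complex_structure J -> 0 <= qform J v.
Proof.
move=> hJ; have [_ _ J0] := complex_structureE hJ.
by rewrite -(pmulr_rge0 _ J0) qform_sos// addr_ge0// sqr_ge0.
Qed.

(** In the coordinates [J 1 0 * v 0 0 - J 0 0 * v 1 0] and [v 1 0] of [qform_sos], the matrix
    [rotation J t] acts as the ordinary rotation of angle [t]. *)
Lemma qform_rotation J t v : complex_structure J -> qform J (rotation J t *m v) = qform J v.
Proof.
move=> hJ; have [h0 h1 J0] := complex_structureE hJ.
apply: (@mulfI _ (J 1 0)); first by rewrite gt_eqF.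
rewrite !qform_sos// !rotationE !mulmx_col2 h0.
set x := v 0 0; set y := v 1 0; set k := J 1 0; set p := J 0 0.
have -> : k * (cos t * x + sin t * (p * x + J 0 1 * y)) -
    p * (cos t * y + sin t * (k * x + - p * y)) =
    cos t * (k * x - p * y) + sin t * ((J 0 1 * k) * y + p ^+ 2 * y) by ring.
rewrite h1 -/p.
have -> : (k * x - p * y) ^+ 2 + y ^+ 2 = 
   (cos t ^+ 2 + sin t ^+ 2) * ((k * x - p * y) ^+ 2 + y ^+ 2).
  by rewrite cos2Dsin2 mul1r.
by ring.
Qed.

Lemma gauge_rotation J t v : complex_structure J -> gauge J (rotation J t *m v) = gauge J v.
Proof. by move=> hJ; rewrite /gauge qform_rotation. Qed.

Lemma gauge_sqr J v : complex_structure J -> gauge J v ^+ 2 = qform J v.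
Proof. by move=> hJ; rewrite sqr_sqrtr// qform_ge0. Qed.

Lemma qformZ J (a : R) v : qform J (a *: v) = a ^+ 2 * qform J v.
Proof. by rewrite /qform !mxE; ring. Qed.

Lemma qform_parallelogram J v w :
  qform J (v + w) + qform J (v - w) = 2 * (qform J v + qform J w).
Proof. by rewrite /qform !mxE; ring. Qed.

Lemma qform_eq0 J v : complex_structure J -> qform J v = 0 -> v = 0.
Proof.
move=> hJ h; have [_ _ J0] := complex_structureE hJ.
have := qform_sos v hJ; rewrite h mulr0 => /esym/eqP.
rewrite paddr_eq0 ?sqr_ge0// !sqrf_eq0 => /andP[/eqP h0 /eqP h1].
move: h0; rewrite h1 mulr0 subr0 => /eqP; rewrite mulf_eq0 gt_eqF//= => /eqP h0.
by apply: col2P; rewrite mxE.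
Qed.

Lemma gauge_norm J : complex_structure J -> is_norm (gauge J).
Proof.
move=> hJ; have [_ h1 J0] := complex_structureE hJ; split.
- by move=> v; exact: sqrtr_ge0.
- move=> v /(congr1 (fun x => x ^+ 2)); rewrite gauge_sqr// expr0n/=.
  exact: qform_eq0.
- by move=> a v; rewrite /gauge qformZ sqrtrM ?sqr_ge0// sqrtr_sqr.
- move=> v w.
  have v0 := sqrtr_ge0 (qform J v); have w0 := sqrtr_ge0 (qform J w).
  rewrite -[leLHS]ger0_norm ?sqrtr_ge0// -[leRHS]ger0_norm ?addr_ge0//.
  rewrite -ler_sqr ?nnegrE ?normr_ge0// !real_normK ?num_real// sqrrD !gauge_sqr//.
  (* The polar form of [qform J]. The triangle inequality reduces to Cauchy-Schwarz for [b], proved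
     by Lagrange's identity in the coordinates of [qform_sos]. *)
  pose b := J 1 0 * v 0 0 * w 0 0 - J 0 0 * (v 0 0 * w 1 0 + v 1 0 * w 0 0)
    - J 0 1 * v 1 0 * w 1 0.
  have -> : qform J (v + w) = qform J v + b *+ 2 + qform J w.
    by rewrite /qform /b !mxE; ring.
  rewrite lerD2r lerD2l lerMn2r/=.
  apply: (le_trans (ler_norm _)).
  rewrite -ler_sqr ?nnegrE ?normr_ge0 ?mulr_ge0// real_normK ?num_real// exprMn !gauge_sqr//.
  rewrite -(@ler_pM2l _ (J 1 0 ^+ 2)) ?exprn_gt0//.
  have -> : J 1 0 ^+ 2 * (qform J v * qform J w) =
    (J 1 0 * qform J v) * (J 1 0 * qform J w) by ring.
  rewrite !qform_sos// -exprMn.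
  have -> : J 1 0 * b = (J 1 0 * v 0 0 - J 0 0 * v 1 0) *
     (J 1 0 * w 0 0 - J 0 0 * w 1 0) + v 1 0 * w 1 0.
    transitivity (J 1 0 ^+ 2 * v 0 0 * w 0 0 - J 1 0 * J 0 0 * (v 0 0 * w 1 0 + v 1 0 * w 0 0)
      - (J 0 1 * J 1 0) * v 1 0 * w 1 0); first by rewrite /b; ring.
    by rewrite h1; ring.
  set a := _ - _; set c := _ - _.
  rewrite -subr_ge0 (_ : _ - _ = (a * w 1 0 - c * v 1 0) ^+ 2) ?sqr_ge0//.
  by ring.
Qed.

End ComplexStructure.

(** * Computing the joint spectral radius from an extremal norm *)

Section JointSpectralRadius.
Variable R : realType.
Implicit Types (A B : 'M[R]_2) (v w : 'cV[R]_2) (N : 'cV[R]_2 -> R) (S : set 'M[R]_2).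

Lemma euclidean_norm2E v : euclidean_norm v = Num.sqrt (v 0 0 ^+ 2 + v 1 0 ^+ 2).
Proof.
rewrite /euclidean_norm big_ord_recl big_ord1.
by congr (Num.sqrt (_ + v _ _ ^+ 2)); exact/val_inj.
Qed.

Lemma euclidean_norm_delta : euclidean_norm (delta_mx 0 0 : 'cV[R]_2) = 1.
Proof. by rewrite euclidean_norm2E !mxE/= expr1n expr0n addr0 sqrtr1. Qed.

Lemma operator_norm_le A (c : R) :
  (forall v, euclidean_norm (A *m v) <= c * euclidean_norm v) ->
  operator_norm A <= c.
Proof.
move=> Ac; apply: ge_sup.
  by exists (euclidean_norm (A *m delta_mx 0 0)); exists (delta_mx 0 0);
     rewrite //= euclidean_norm_delta.
by move=> _ [v /= v1 <-]; rewrite -[c]mulr1 -v1.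
Qed.

(** The upper bound [c] makes the supremum a genuine one, since [sup] takes a default value on
    unbounded sets. *)
Lemma le_operator_norm A (c d : R) :
  (forall v, d * euclidean_norm v <= euclidean_norm (A *m v) <= c * euclidean_norm v) ->
  d <= operator_norm A.
Proof.
move=> Ac; have /andP[dA _] := Ac (delta_mx 0 0).
rewrite euclidean_norm_delta mulr1 in dA; apply: (le_trans dA).
apply: ub_le_sup; last by exists (delta_mx 0 0); rewrite //= euclidean_norm_delta.
by exists c => _ [v /= v1 <-]; have /andP[_] := Ac v; rewrite v1 mulr1.
Qed.

Lemma operator_norm_ge0 A (c : R) :
  (forall v, euclidean_norm (A *m v) <= c * euclidean_norm v) ->
  0 <= operator_norm A.
Proof.
move=> Ac; apply: (@le_operator_norm A c) => v.
by rewrite mul0r sqrtr_ge0 Ac.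
Qed.

Lemma norm_prod_le N (r : R) (n : nat) (F : 'I_n -> 'M[R]_2) v : 0 <= r ->
  (forall i v, N (F i *m v) <= r * N v) ->
  N ((\prod_i F i) *m v) <= r ^+ n * N v.
Proof.
move=> r0; elim: n F v => [|n IH] F v FN.
  by rewrite big_ord0 mul1mx mul1r.
rewrite big_ord_recl -mulmxE -mulmxA exprS -mulrA.
apply: (le_trans (FN _ _)); apply: ler_wpM2l => //.
by apply: IH => i w; exact: FN.
Qed.

Lemma cvg_root (c : R) : 0 < c -> c `^ n%:R^-1 @[n --> \oo] --> (1 : R).
Proof.
move=> c0; rewrite -(cvg_shiftS _ (nbhs (1 : R))).
have -> : [sequence c `^ n.+1%:R^-1]_n = expR \o (fun n => n.+1%:R^-1 * ln c).
  by apply/funext => n /=; rewrite /powR gt_eqF.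
suff h : n.+1%:R^-1 * ln c @[n --> \oo] --> (0 : R).
  have := continuous_cvg _ (@continuous_expR R 0) h; rewrite expR0; exact.
have := cvgMr_tmp (b := ln c) (@cvg_harmonic R); rewrite mul0r; exact.
Qed.

(** With [K = c2 / c1], comparing [N] with the Euclidean norm bounds every word of length [n] by
    [K * r ^+ n], while the word [A ^+ n] has norm at least [K^-1 * r ^+ n]. The [n]-th roots of
    both constants tend to 1. *)
Lemma joint_spectral_radiusE S N (r c1 c2 : R) A : 0 < r -> 0 < c1 ->
  (forall v, c1 * euclidean_norm v <= N v <= c2 * euclidean_norm v) ->
  (forall B, S B -> forall v, N (B *m v) <= r * N v) ->
  S A -> (forall v, N (A *m v) = r * N v) ->
  joint_spectral_radius S = r.
Proof.
move=> r0 c10 Nc SN SA AN.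
have c20 : 0 < c2.
  have /andP[h1 h2] := Nc (delta_mx 0 0).
  by have := le_trans h1 h2; rewrite euclidean_norm_delta !mulr1; apply: lt_le_trans.
pose K := c2 / c1; have K0 : 0 < K by rewrite divr_gt0.
have up n (F : 'I_n -> 'M[R]_2) v : (forall i, S (F i)) ->
    euclidean_norm (word_product F *m v) <= K * r ^+ n * euclidean_norm v.
  move=> SF; rewrite -(ler_pM2l c10).
  have /andP[h _] := Nc (word_product F *m v); apply: (le_trans h).
  apply: (le_trans (norm_prod_le v (ltW r0) _)).
    by move=> i w; exact: SN.
  have -> : c1 * (K * r ^+ n * euclidean_norm v) = r ^+ n * (c2 * euclidean_norm v).
    by rewrite /K; field; rewrite gt_eqF.
  by rewrite ler_pM2l ?exprn_gt0//; case/andP: (Nc v).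
have low n v : K^-1 * r ^+ n * euclidean_norm v <=
    euclidean_norm (word_product (fun _ : 'I_n => A) *m v).
  rewrite -(ler_pM2l c20).
  have /andP[_ h] := Nc (word_product (fun _ : 'I_n => A) *m v); apply: (le_trans _ h).
  have -> : N (word_product (fun _ : 'I_n => A) *m v) = r ^+ n * N v.
    rewrite /word_product prodr_const card_ord; elim: n {h} => [|n IH].
      by rewrite !expr0 mul1mx mul1r.
    by rewrite !exprS -mulmxE -mulmxA AN IH mulrA.
  have -> : c2 * (K^-1 * r ^+ n * euclidean_norm v) = r ^+ n * (c1 * euclidean_norm v).
    by rewrite /K; field; rewrite !gt_eqF.
  by rewrite ler_pM2l ?exprn_gt0//; case/andP: (Nc v).
have rootM n (c : R) : (0 < n)%N -> 0 < c -> (c * r ^+ n) `^ n%:R^-1 = c `^ n%:R^-1 * r.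
  move=> n0 c0; rewrite powRM ?exprn_ge0 ?ltW//; congr (_ * _).
  rewrite -powR_mulrn ?ltW// -powRrM divff ?pnatr_eq0 -?lt0n//.
  by rewrite powRr1// ltW.
apply: cvg_lim => //.
apply: (@squeeze_cvgr _ _ _ _ (fun n => K^-1 `^ n%:R^-1 * r) (fun n => K `^ n%:R^-1 * r)).
(* Length 0 is discarded: there the exponent is [0^-1 = 0] and [rootM] can fail. *)
- exists 1%N => // n /= n0; rewrite -!rootM ?invr_gt0//.
  have ub : ubound [set operator_norm (word_product M) `^ n%:R^-1 |
      M in [set M : 'I_n -> 'M[R]_2 | forall i, S (M i)]] ((K * r ^+ n) `^ n%:R^-1).
    move=> _ [F /= SF <-]; apply: ge0_ler_powR.
    - by rewrite invr_ge0.
    - by rewrite nnegrE; apply: (@operator_norm_ge0 _ (K * r ^+ n)) => v; exact: up.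
    - by rewrite nnegrE mulr_ge0 ?exprn_ge0// ltW.
    - by apply: operator_norm_le => v; exact: up.
  have inA : [set operator_norm (word_product M) `^ n%:R^-1 |
      M in [set M : 'I_n -> 'M[R]_2 | forall i, S (M i)]]
      (operator_norm (word_product (fun _ : 'I_n => A)) `^ n%:R^-1).
    by exists (fun=> A).
  apply/andP; split; last by apply: ge_sup ub; eexists; exact: inA.
  apply: le_trans (ub_le_sup _ inA); last by exists ((K * r ^+ n) `^ n%:R^-1).
  have h0 : K^-1 * r ^+ n <= operator_norm (word_product (fun _ : 'I_n => A)).
    by apply: (@le_operator_norm _ (K * r ^+ n)) => v; rewrite low up.
  have h1 : 0 <= K^-1 * r ^+ n by rewrite mulr_ge0 ?exprn_ge0 ?invr_ge0// ltW.
  apply: ge0_ler_powR; rewrite ?nnegrE ?invr_ge0//.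
  exact: le_trans h0.
- have := cvgMr_tmp (b := r) (@cvg_root K^-1 _); rewrite mul1r invr_gt0; exact.
- have := cvgMr_tmp (b := r) (cvg_root K0); rewrite mul1r; exact.
Qed.

Lemma sup_pair (x y : R) : y <= x -> sup [set x; y] = x.
Proof.
move=> yx; apply/eqP; rewrite eq_le; apply/andP; split.
  by apply: ge_sup; [exists x; left | move=> _ [->|->]].
by apply: ub_le_sup; [exists x => _ [->|->] | left].
Qed.

Lemma barabanov_norm_pair A B N r : is_norm N ->
  joint_spectral_radius [set A; B] = r ->
  (forall v, N (A *m v) = r * N v) -> (forall v, N (B *m v) <= r * N v) ->
  barabanov_norm [set A; B] N.
Proof.
move=> nN rho AN BN; split=> // v; rewrite rho.
by rewrite image_setU !image_set1 sup_pair ?AN.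
Qed.

Lemma barabanov_norm_le A B N v : barabanov_norm [set A; B] N ->
  N (A *m v) <= joint_spectral_radius [set A; B] * N v.
Proof.
move=> [_ NE]; rewrite NE image_setU !image_set1.
apply: ub_le_sup; last by left.
exists (Num.max (N (A *m v)) (N (B *m v))) => _ [->|->]; rewrite le_max lexx ?orbT//.
Qed.

End JointSpectralRadius.

(** * Irrational rotations and the norms they do not increase *)

Section IrrationalRotation.
Variable R : realType.

(** Pigeonhole: among the fractional parts of [i * x] for [i] from 0 to [K], two lie in the same of
    the [K] intervals of length [1 / K < e]. *)
Lemma dirichlet_approximation (x e : R) : 0 < e ->
  exists (n : nat) (m : int), (0 < n)%N /\ `|n%:R * x - m%:~R| < e.
Proof.
move=> e0; pose K := (Num.truncn e^-1).+1.
have K0 : 0 < K%:R :> R by rewrite ltr0n.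
have Ke : K%:R^-1 < e.
  by rewrite invf_plt ?posrE// real_truncnS_gt ?num_real.
pose fr (i : nat) := i%:R * x - (Num.floor (i%:R * x))%:~R.
have fr01 i : 0 <= fr i < 1.
  have /andP[h1 h2] := floor_itv (i%:R * x).
  by rewrite intrD in h2; rewrite subr_ge0 h1 /= ltrBlDl.
have frK i : (Num.truncn (K%:R * fr i) < K)%N.
  have /andP[h1 h2] := fr01 i.
  have Kf : 0 <= K%:R * fr i by rewrite mulr_ge0.
  rewrite -(ltr_nat R); have /andP[h _] := truncn_itv Kf.
  by apply: (le_lt_trans h); rewrite gtr_pMr.
pose f (i : 'I_K.+1) : 'I_K := Ordinal (frK i).
have /injectivePn[i [j ij fij]] : ~~ injectiveb f.
  apply/negP => /injectiveP/leq_card; rewrite !card_ord ltnn//.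
wlog lt_ij : i j ij fij / (i < j)%N.
  move=> W; have [h|h|h] := ltngtP i j; first exact: (W i j).
    by apply: (W j i) => //; rewrite eq_sym.
  by case/eqP: ij; exact/val_inj.
exists (j - i)%N, (Num.floor (j%:R * x) - Num.floor (i%:R * x)); split; first by rewrite subn_gt0.
rewrite natrB ?(ltnW lt_ij)// intrB.
have -> : (j%:R - i%:R) * x - ((Num.floor (j%:R * x))%:~R - (Num.floor (i%:R * x))%:~R)
   = fr j - fr i by rewrite /fr; ring.
apply: le_lt_trans Ke; rewrite -(ler_pM2l K0) divff ?gt_eqF//.
have /andP[/(mulr_ge0 (ltW K0))/truncn_itv/andP[i1 i2] _] := fr01 i.
have /andP[/(mulr_ge0 (ltW K0))/truncn_itv/andP[j1 j2] _] := fr01 j.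
move/(congr1 val): fij => /= fij; rewrite fij in i1 i2.
rewrite -(gtr0_norm K0) -normrM mulrBr ler_norml.
rewrite -natr1 in i2 j2; apply/andP; split; lra.
Qed.

(** Dirichlet's theorem puts an element [d] with [|d| < e] in [S], nonzero because [x] is
    irrational. Only nonnegative multiples of [d] are available, so the sign of [d] decides from
    which neighbouring integer [t] is approached. *)
Lemma semigroup_dense (S : set R) (x : R) :
  (forall s t, S s -> S t -> S (s + t)) -> (forall m : int, S m%:~R) ->
  S x -> irrational x -> forall t e : R, 0 < e -> exists2 s, S s & `|t - s| < e.
Proof.
move=> SD Sint Sx xirr t e e0.
have SM (k : nat) s : S s -> S (k%:R * s).
  move=> Ss; elim: k => [|k IH]; first by rewrite mul0r; exact: (Sint 0).
  by rewrite -natr1 mulrDl mul1r; exact: SD.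
have [n [m [n0 nm]]] := dirichlet_approximation x e0.
set d := _ - _ in nm.
have Sd : S d by apply: SD; [exact: SM | rewrite -rmorphN; exact: Sint].
have d0 : d != 0.
  apply/eqP => dE; apply: xirr; apply/rationalP; exists m, n.
  apply: (@mulfI _ n%:R); first by rewrite pnatr_eq0 -lt0n.
  by rewrite mulrCA divff ?pnatr_eq0 -?lt0n// mulr1; apply/eqP; rewrite -subr_eq0; exact/eqP.
have /andP[t1 t2] := floor_itv t; rewrite intrD in t2.
have [dn|dp|/eqP] := ltgtP d 0; last by rewrite (negbTE d0).
(* For negative [d], descend from the integer [floor t + 1] above [t]. *)
- rewrite ltr0_norm// in nm.
  have u0 : 0 <= ((Num.floor t + 1)%:~R - t) / - d.
    by rewrite mulr_ge0 ?invr_ge0 ?intrD//; lra.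
  have /andP[k1 k2] := truncn_itv u0; set k := Num.truncn _ in k1 k2.
  exists ((Num.floor t + 1)%:~R + k%:R * d); first by apply: SD; [exact: Sint|exact: SM].
  rewrite ler_pdivlMr ?oppr_gt0// in k1.
  rewrite ltr_pdivrMr ?oppr_gt0// -natr1 in k2.
  by rewrite ltr_norml; apply/andP; split; lra.
(* For positive [d], climb from [floor t]. *)
- rewrite gtr0_norm// in nm.
  have u0 : 0 <= (t - (Num.floor t)%:~R) / d.
    by rewrite mulr_ge0 ?invr_ge0 ?(ltW dp) ?subr_ge0.
  have /andP[k1 k2] := truncn_itv u0; set k := Num.truncn _ in k1 k2.
  exists ((Num.floor t)%:~R + k%:R * d); first by apply: SD; [exact: Sint|exact: SM].
  rewrite ler_pdivlMr// in k1.
  rewrite ltr_pdivrMr// -natr1 in k2.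
  by rewrite ltr_norml; apply/andP; split; lra.
Qed.

Implicit Types (A B J : 'M[R]_2) (v w : 'cV[R]_2) (s t : R) (N : 'cV[R]_2 -> R).

Lemma is_norm0 N : is_norm N -> N 0 = 0.
Proof. by move=> [_ _ NZ _]; rewrite -(scale0r 0) NZ normr0 mul0r. Qed.

Lemma is_norm_gt0 N v : is_norm N -> v != 0 -> 0 < N v.
Proof.
move=> [N0 N00 _ _] v0; rewrite lt_neqAle N0 andbT eq_sym.
by apply: contra v0 => /eqP/N00/eqP.
Qed.

(** Controls rotations of small angle through the continuity of [sin] at 0 alone, so that continuity
    of [N] need not be established. *)
Lemma norm_rotation_le J N t v : is_norm N -> N (rotation J t *m v) <= N v + `|sin t| * N (J *m v).
Proof.
move=> [N0 _ NZ ND]; rewrite /rotation mulmxDl mul_scalar_mx -scalemxAl.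
apply: (le_trans (ND _ _)); rewrite !NZ lerD2r ler_piMl//.
by rewrite ler_norml cos_geN1 cos_le1.
Qed.

Lemma rotation_int_pi J (m : int) : exists2 e : R, `|e| = 1 & rotation J (pi * m%:~R) = e%:M.
Proof.
have rotpi (n : nat) : exists2 e : R, `|e| = 1 & cos (pi * n%:R) = e /\ sin (pi * n%:R) = 0 :> R.
  elim: n => [|n [e e1 [cE sE]]].
    by exists 1; [exact: normr1 | rewrite mulr0 cos0 sin0].
  exists (- e); first by rewrite normrN.
  by rewrite -natr1 mulrDr mulr1 cosDpi sinDpi cE sE oppr0.
case: m => n.
  have [e e1 [cE sE]] := rotpi n; exists e => //.
  by rewrite /rotation -pmulrn cE sE scale0r addr0.
have [e e1 [cE sE]] := rotpi n.+1; exists e => //.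
by rewrite /rotation NegzE rmorphN/= mulrN cosN sinN -pmulrn cE sE oppr0 scale0r addr0.
Qed.

(* The angles [t] such that [N (rotation J t *m v) <= N v] for all [v] form a closed
   semigroup, which contains the integer multiples of [pi]. *)
Lemma norm_rotation_invariant J N t : complex_structure J -> is_norm N ->
  irrational (t / pi) -> (forall v, N (rotation J t *m v) <= N v) ->
  forall s v, N (rotation J s *m v) = N v.
Proof.
move=> hJ nN tirr tN; have [N0 _ NZ _] := nN.
have pi0 := pi_gt0 R.
(* Applying the inequality to the angle [- s] as well yields equality. *)
suff le s v : N (rotation J s *m v) <= N v.
  move=> s v; apply/eqP; rewrite eq_le le/=.
  have := le (- s) (rotation J s *m v).
  rewrite mulmxA -rotationD// addNr /rotation cos0 sin0 scale0r addr0 mul1mx; exact.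
pose S := [set x : R | forall v, N (rotation J (pi * x) *m v) <= N v].
have SD x y : S x -> S y -> S (x + y).
  move=> Sx Sy w; rewrite mulrDr rotationD// -mulmxA.
  exact: le_trans (Sx _) (Sy _).
have Sint (m : int) : S m%:~R.
  by move=> w; have [e e1 ->] := rotation_int_pi J m; rewrite mul_scalar_mx NZ e1 mul1r.
have St : S (t / pi) by move=> w; rewrite mulrCA divff ?mulr1 ?gt_eqF.
apply/ler_addgt0Pr => e e0.
(* The angle [s] is split into an angle of the semigroup and a remainder so small that its sine
   times [N (J *m v)] is at most [e]; adding 1 avoids a zero denominator. *)
have C0 : 0 < e / (N (J *m v) + 1) by rewrite divr_gt0// ltr_wpDl.
have /cvgrPdist_lt/(_ _ C0) := @continuous_sin R 0.
move=> /nbhs_ballP[d /= d0 sd].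
have [x Sx] := semigroup_dense SD Sint St tirr (s / pi) (divr_gt0 d0 pi0).
rewrite ltr_pdivlMr// -[X in _ * X]gtr0_norm// -normrM mulrBl divfK ?gt_eqF// mulrC => xd.
have -> : s = pi * x + (s - pi * x) by ring.
rewrite rotationD// -mulmxA; apply: (le_trans (Sx _)).
apply: (le_trans (norm_rotation_le _ _ _ nN)); rewrite lerD2l.
have := sd (s - pi * x); rewrite /ball/= sub0r normrN => /(_ xd).
rewrite sin0 sub0r normrN ltr_pdivlMr ?ltr_wpDl// => /ltW; apply: le_trans.
by rewrite ler_wpM2l// lerDl.
Qed.

Lemma polar_angle (a b : R) : a ^+ 2 + b ^+ 2 = 1 -> exists t, a = cos t /\ b = sin t.
Proof.
move=> ab.
have a1 : -1 <= a <= 1.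
  by rewrite -ler_norml -(@ler_pXn2r _ 2) ?nnegrE// expr1n real_normK ?num_real// -ab lerDl sqr_ge0.
have sE : Num.sqrt (1 - a ^+ 2) = `|b|.
  by rewrite -ab addrAC subrr add0r sqrtr_sqr.
have [b0|b0] := leP 0 b.
  by exists (acos a); rewrite acosK ?in_itv//= sin_acos// sE ger0_norm.
by exists (- acos a); rewrite cosN acosK ?in_itv//= sinN sin_acos// sE ltr0_norm// opprK.
Qed.

(** The rotations act transitively on each level set of [gauge J], so every vector is a positive
    multiple of a rotated copy of [u], except 0. *)
Lemma rotation_invariant_norm J N : complex_structure J -> is_norm N ->
  (forall t v, N (rotation J t *m v) = N v) ->
  exists2 c : R, 0 < c & forall v, N v = c * gauge J v.
Proof.
move=> hJ nN Nrot; have [_ _ k0] := complex_structureE hJ.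
have [_ _ NZ _] := nN.
pose u : 'cV[R]_2 := delta_mx 0 0.
have u0 : u != 0.
  apply/eqP => /(congr1 (fun w : 'cV[R]_2 => w 0 0)); rewrite !mxE/=.
  by move/eqP; rewrite oner_eq0.
have gu : qform J u = J 1 0.
  by rewrite /qform !mxE/=; ring.
exists (N u / gauge J u); first by rewrite divr_gt0 ?is_norm_gt0//; exact: gauge_norm.
move=> v; have [->|v0] := eqVneq v 0.
  by rewrite !is_norm0 ?mulr0//; exact: gauge_norm.
have gv0 : 0 < gauge J v by apply: is_norm_gt0 => //; exact: gauge_norm.
have gu0 : 0 < gauge J u by apply: is_norm_gt0 => //; exact: gauge_norm.
pose rho := gauge J v / gauge J u; have rho0 : 0 < rho by rewrite divr_gt0.
(* The coordinates of [v] in the basis [u], [J *m u], divided by [rho]. *)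
have [t [ca sb]] : exists t, (v 0 0 - J 0 0 * v 1 0 / J 1 0) / rho = cos t /\
    (v 1 0 / J 1 0) / rho = sin t.
  apply: polar_angle.
  rewrite !expr_div_n -mulrDl !gauge_sqr// gu.
  have qv0 : qform J v != 0 by rewrite -gauge_sqr// expf_neq0 ?gt_eqF.
  have := qform_sos v hJ => qE.
  have -> : qform J v = ((J 1 0 * v 0 0 - J 0 0 * v 1 0) ^+ 2 + v 1 0 ^+ 2) / J 1 0.
    by rewrite -qE mulrAC divff ?mul1r ?gt_eqF.
  by field; rewrite -qE mulf_neq0 ?(gt_eqF k0).
have vE : v = rho *: (rotation J t *m u).
  by apply: col2P; rewrite mxE rotationE mulmx_col2 -ca -sb !mxE/=; field;
     rewrite ?(gt_eqF rho0) ?(gt_eqF k0).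
by rewrite {1}vE NZ Nrot gtr0_norm// /rho; ring.
Qed.

End IrrationalRotation.

(** * Barabanov norms of a scaled rotation paired with a small matrix *)

Section RotationPairs.
Variable R : realType.
Implicit Types (A B J : 'M[R]_2) (v w : 'cV[R]_2) (s t r : R) (N : 'cV[R]_2 -> R).

Lemma qform_trace_gt0 J : complex_structure J -> 0 < J 1 0 - J 0 1.
Proof.
move=> /complex_structureE[_ h1 k0].
rewrite -(pmulr_rgt0 _ k0) mulrBr -[X in _ - X]mulrC h1 opprK.
by rewrite addr_gt0 ?mulr_gt0// ltr_wpDr// sqr_ge0.
Qed.

(** In dimension two, the trace times the squared Euclidean norm, minus the form at [v], is the form
    at [v] turned by a right angle. *)
Lemma qform_le J v : complex_structure J ->
  qform J v <= (J 1 0 - J 0 1) * (v 0 0 ^+ 2 + v 1 0 ^+ 2).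
Proof.
move=> hJ; pose w := \col_(i < 2) (if i == 0 then - v 1 0 else v 0 0).
have := qform_ge0 w hJ; rewrite -subr_ge0 => h; rewrite -subr_ge0.
by apply: le_trans h _; rewrite /qform !mxE/= subr0 le_eqVlt; apply/orP; left; apply/eqP; ring.
Qed.

(** The symmetric matrix [Q] of [qform J] has determinant 1, so by Cayley-Hamilton its trace [T]
    satisfies [T Q - 1 = Q^2], and the difference of the two sides is the squared Euclidean norm of
    [Q v]. *)
Lemma le_qform J v : complex_structure J ->
  v 0 0 ^+ 2 + v 1 0 ^+ 2 <= (J 1 0 - J 0 1) * qform J v.
Proof.
move=> hJ; have [_ h1 k0] := complex_structureE hJ.
rewrite mulrBl qform_sos// -subr_ge0.
have -> : (J 1 0 * v 0 0 - J 0 0 * v 1 0) ^+ 2 + v 1 0 ^+ 2 - J 0 1 * qform J v -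
  (v 0 0 ^+ 2 + v 1 0 ^+ 2) = (J 1 0 * v 0 0 - J 0 0 * v 1 0) ^+ 2 +
   (J 0 1 * v 1 0 + J 0 0 * v 0 0) ^+ 2.
  transitivity ((J 1 0 * v 0 0 - J 0 0 * v 1 0) ^+ 2
    - (J 0 1 * J 1 0) * v 0 0 ^+ 2 + 2 * J 0 1 * J 0 0 * v 0 0 * v 1 0
    + J 0 1 ^+ 2 * v 1 0 ^+ 2 - v 0 0 ^+ 2); first by rewrite /qform; ring.
  by rewrite h1; ring.
by rewrite addr_ge0 ?sqr_ge0.
Qed.

Lemma gauge_bounds J : complex_structure J ->
  exists c1 c2 : R, 0 < c1 /\
    forall v, c1 * euclidean_norm v <= gauge J v <= c2 * euclidean_norm v.
Proof.
move=> hJ; have T0 := qform_trace_gt0 hJ; set T := J 1 0 - J 0 1 in T0.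
exists (Num.sqrt T^-1), (Num.sqrt T); split; first by rewrite sqrtr_gt0 invr_gt0.
move=> v; rewrite euclidean_norm2E -!sqrtrM ?invr_ge0 ?(ltW T0)//.
apply/andP; split; apply: ler_wsqrtr; last exact: qform_le.
by rewrite mulrC ler_pdivrMr// mulrC le_qform.
Qed.

Section Pair.
Variables (J B : 'M[R]_2) (r t : R).
Hypotheses (hJ : complex_structure J) (r0 : 0 < r).
(** The factor 4, that is 2 for [gauge J], leaves room for norms between [gauge J] and
    [2 * gauge J], such as the one in [orbit_barabanov]. *)
Hypothesis smallB : forall v, 4 * qform J (B *m v) <= r ^+ 2 * qform J v.

Let A := r *: rotation J t.
Let AB : set 'M[R]_2 := [set A; B].

Lemma gauge_small v : 2 * gauge J (B *m v) <= r * gauge J v.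
Proof.
have g0 w : 0 <= gauge J w by exact: sqrtr_ge0.
rewrite -(@ler_pXn2r _ 2) ?nnegrE ?mulr_ge0 ?(ltW r0)//.
by rewrite !exprMn !gauge_sqr// -natrX smallB.
Qed.

Lemma gauge_dominant v : gauge J (A *m v) = r * gauge J v.
Proof.
rewrite /A -scalemxAl; have [_ _ -> _] := gauge_norm hJ.
by rewrite gauge_rotation// gtr0_norm.
Qed.

Lemma gauge_le v : gauge J (B *m v) <= r * gauge J v.
Proof.
apply: le_trans (gauge_small v).
by rewrite ler_peMl ?sqrtr_ge0// ler1n.
Qed.

Lemma joint_spectral_radius_pair : joint_spectral_radius AB = r.
Proof.
have [c1 [c2 [c10 hc]]] := gauge_bounds hJ.
apply: (joint_spectral_radiusE r0 c10 hc (A := A)).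
- by move=> _ [->|->] v; [rewrite gauge_dominant | exact: gauge_le].
- by left.
- exact: gauge_dominant.
Qed.

Lemma gauge_barabanov : barabanov_norm AB (gauge J).
Proof.
apply: barabanov_norm_pair; [exact: gauge_norm | exact: joint_spectral_radius_pair
  | exact: gauge_dominant | exact: gauge_le].
Qed.

Lemma irrational_pair_unique : irrational (t / pi) -> has_unique_barabanov_norm AB.
Proof.
move=> tirr; split; first by exists (gauge J); exact: gauge_barabanov.
have prop N : barabanov_norm AB N -> exists2 c : R, 0 < c & forall v, N v = c * gauge J v.
  move=> bN; have nN : is_norm N by case: bN.
  apply: (rotation_invariant_norm hJ nN).
  apply: (norm_rotation_invariant hJ nN tirr) => v.
  have := barabanov_norm_le v bN; rewrite joint_spectral_radius_pair /A -scalemxAl.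
  by have [_ _ -> _] := nN; rewrite gtr0_norm// ler_pM2l.
move=> N1 N2 /prop[c c0 N1E] /prop[d d0 N2E]; exists (c / d); first exact: divr_gt0.
by move=> v; rewrite N1E N2E mulrA divfK ?gt_eqF.
Qed.

(** The averaged seminorm is the height [|v 1 0|], which has a corner along the first axis. Dividing
    by the root of [J 1 0] keeps it below [gauge J]. *)
Definition orbit_seminorm (m : nat) v : R :=
  m%:R^-1 * \sum_(j < m) `|(rotation J (j%:R * t) *m v) 1 0| / Num.sqrt (J 1 0).

Lemma orbit_seminorm_ge0 m v : 0 <= orbit_seminorm m v.
Proof.
by rewrite mulr_ge0 ?invr_ge0// sumr_ge0// => i _; rewrite divr_ge0 ?sqrtr_ge0.
Qed.

Lemma orbit_seminormZ m (a : R) v : orbit_seminorm m (a *: v) = `|a| * orbit_seminorm m v.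
Proof.
rewrite /orbit_seminorm [RHS]mulrCA; congr (_ * _); rewrite mulr_sumr.
by apply: eq_bigr => j _; rewrite -scalemxAr mxE normrM mulrA.
Qed.

Lemma orbit_seminormD m v w :
  orbit_seminorm m (v + w) <= orbit_seminorm m v + orbit_seminorm m w.
Proof.
rewrite /orbit_seminorm -mulrDr ler_wpM2l ?invr_ge0// -big_split/=.
apply: ler_sum => j _; rewrite -mulrDl ler_wpM2r ?invr_ge0 ?sqrtr_ge0//.
by rewrite mulmxDr mxE ler_normD.
Qed.

Lemma height_le_gauge v : `|v 1 0| / Num.sqrt (J 1 0) <= gauge J v.
Proof.
have [_ _ k0] := complex_structureE hJ.
rewrite ler_pdivrMr ?sqrtr_gt0// -sqrtrM ?qform_ge0// -sqrtr_sqr ler_wsqrtr//.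
by rewrite mulrC qform_sos// lerDr sqr_ge0.
Qed.

Lemma orbit_seminorm_le m v : orbit_seminorm m v <= gauge J v.
Proof.
case: m => [|m].
  by rewrite /orbit_seminorm big_ord0 mulr0 sqrtr_ge0.
rewrite /orbit_seminorm mulrC ler_pdivrMr// mulrC.
have -> : m.+1%:R * gauge J v = \sum_(j < m.+1) gauge J v.
  by rewrite sumr_const card_ord mulr_natl.
apply: ler_sum => j _; rewrite -(gauge_rotation (j%:R * t) v hJ).
exact: height_le_gauge.
Qed.

(** Rotating by [t] shifts the terms of the sum by one. The new last term has angle [pi * n], where
    the rotation is the identity up to sign, so it equals the lost first term. *)
Lemma orbit_seminorm_rotation (m : nat) (n : int) v : m%:R * t = pi * n%:~R ->
  orbit_seminorm m (rotation J t *m v) = orbit_seminorm m v.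
Proof.
move=> mt; case: m mt => [|m] mt; first by rewrite /orbit_seminorm !big_ord0.
congr (_ * _); rewrite -!mulr_suml; congr (_ / _).
rewrite big_ord_recr [RHS]big_ord_recl/= addrC; congr (_ + _).
  rewrite mulmxA -rotationD// mul0r.
  have -> : m%:R * t + t = pi * n%:~R by rewrite -mt -natr1 mulrDl mul1r.
  have [e e1 ->] := rotation_int_pi J n.
  by rewrite /rotation cos0 sin0 scale0r addr0 mul1mx mul_scalar_mx mxE normrM e1 mul1r.
apply: eq_bigr => j _; rewrite mulmxA -rotationD//; congr (`|(rotation _ _ *m _) _ _|).
by rewrite /bump/= add1n -natr1 mulrDl mul1r.
Qed.

Lemma orbit_barabanov (m : nat) (n : int) : m%:R * t = pi * n%:~R ->
  barabanov_norm AB (fun v => gauge J v + orbit_seminorm m v).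
Proof.
move=> mt; have [g0 g00 gZ gD] := gauge_norm hJ.
apply: barabanov_norm_pair.
- split.
  + by move=> v; rewrite addr_ge0 ?orbit_seminorm_ge0.
  + move=> v /eqP; rewrite paddr_eq0 ?orbit_seminorm_ge0// => /andP[/eqP h _].
    exact: g00.
  + by move=> a v; rewrite gZ orbit_seminormZ mulrDr.
  + by move=> v w; rewrite addrACA lerD// orbit_seminormD.
- exact: joint_spectral_radius_pair.
- move=> v; rewrite gauge_dominant /A -scalemxAl orbit_seminormZ.
  by rewrite (orbit_seminorm_rotation _ mt) gtr0_norm// mulrDr.
- move=> v; apply: (@le_trans _ _ (2 * gauge J (B *m v))).
    by rewrite mulr_natl mulr2n lerD2l orbit_seminorm_le.
  apply: (le_trans (gauge_small v)).
  by rewrite ler_pM2l// lerDl orbit_seminorm_ge0.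
Qed.

(* A multiple of [gauge J] satisfies the parallelogram law, while [orbit_seminorm]
   has a corner at the first basis vector, in the direction of the second one. *)
Lemma rational_pair_not_unique (m : nat) (n : int) : (0 < m)%N ->
  m%:R * t = pi * n%:~R -> ~ has_unique_barabanov_norm AB.
Proof.
move=> m0 mt [_ /(_ _ _ (orbit_barabanov mt) gauge_barabanov)[c c0 cE]].
have [_ _ k0] := complex_structureE hJ.
pose f := orbit_seminorm m.
(* Proportionality of the two norms makes the seminorm itself a multiple of [gauge J]. *)
have fE v : f v = (c - 1) * gauge J v by rewrite mulrBl mul1r -cE addrC addKr.
have par v w : f (v + w) ^+ 2 + f (v - w) ^+ 2 = 2 * (f v ^+ 2 + f w ^+ 2).
  rewrite !fE !exprMn !gauge_sqr// -mulrDr qform_parallelogram; ring.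
pose x : 'cV[R]_2 := delta_mx 0 0; pose y : 'cV[R]_2 := delta_mx 1 0.
pose a := (m%:R * Num.sqrt (J 1 0))^-1.
have a0 : 0 < a by rewrite invr_gt0 mulr_gt0 ?ltr0n ?sqrtr_gt0.
(* The term [j = 0] vanishes at [x] and contributes [e * a] at each of [x + e *: y] and
   [x - e *: y]; the other terms are convex. *)
have corner (e : R) : 0 < e -> 2 * f x + 2 * e * a <= f (x + e *: y) + f (x - e *: y).
  move=> e0; case: m m0 @f @a {a0 fE par cE mt} => // m' _.
  rewrite /orbit_seminorm !big_ord_recl/= !mul0r.
  set S0 := \sum_(i < _) _; set S1 := \sum_(i < _) _; set S2 := \sum_(i < _) _.
  have SS : 2 * S0 <= S1 + S2.
    rewrite /S0 /S1 /S2 mulr_sumr -big_split/=; apply: ler_sum => i _.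
    rewrite mulrA -mulrDl ler_wpM2r ?invr_ge0 ?sqrtr_ge0//.
    set M := rotation _ _.
    have -> : 2 * `|(M *m x) 1 0| = `|(M *m (x + e *: y)) 1 0 + (M *m (x - e *: y)) 1 0|.
      rewrite -[2]normr_nat -normrM !mulmxDr mulmxN !mxE; congr `|_|; ring.
    exact: ler_normD.
  rewrite /rotation cos0 sin0 scale0r addr0 !mul1mx !mxE/= normr0 mul0r add0r.
  rewrite mulr1 add0r sub0r normrN gtr0_norm// -subr_ge0 invfM.
  set M := _^-1; set q := _^-1; have M0 : 0 <= M by rewrite invr_ge0.
  have -> : M * (e * q + S1) + M * (e * q + S2) - (2 * (M * S0) + 2 * e * (M * q))
    = M * (S1 + S2 - 2 * S0) by ring.
  by rewrite mulr_ge0 ?subr_ge0.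
(* If [f x = 0] then [c = 1] and [f] vanishes everywhere, against [corner] for [e = 1]. *)
have fx0 : 0 < f x.
  rewrite lt_neqAle orbit_seminorm_ge0 andbT eq_sym; apply/eqP => fx.
  have [_ gauge0 _ _] := gauge_norm hJ.
  have gx : gauge J x != 0.
    apply/eqP => /gauge0 /(congr1 (fun w : 'cV[R]_2 => w 0 0)).
    by rewrite !mxE/= => /eqP; rewrite oner_eq0.
  have c1 : c - 1 = 0.
    by move: fx => /eqP; rewrite fE mulf_eq0 (negbTE gx) orbF => /eqP.
  have := corner _ (@ltr01 R); rewrite fx !fE c1 !mul0r; lra.
(* Square [corner], bound [(F1 + F2) ^+ 2] by [2 * (F1 ^+ 2 + F2 ^+ 2)], and use the parallelogram
   law: a gain linear in [e] is bounded by a quadratic one. *)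
have key (e : R) : 0 < e -> 2 * a * f x <= e * f y ^+ 2.
  move=> e0; have := corner e e0; have := par x (e *: y).
  have -> : f (e *: y) = e * f y by rewrite /f orbit_seminormZ gtr0_norm.
  set F1 := f (_ + _); set F2 := f (_ - _) => FF le.
  have h1 : (2 * f x + 2 * e * a) ^+ 2 <= (F1 + F2) ^+ 2.
    have f0 w : 0 <= f w by exact: orbit_seminorm_ge0.
    have l0 : 0 <= 2 * f x + 2 * e * a.
      by apply: addr_ge0; apply: mulr_ge0 => //; [exact: mulr_ge0 (ltW _) | exact: ltW].
    have r0' : 0 <= F1 + F2 by apply: addr_ge0; exact: f0.
    by rewrite ler_pXn2r.
  have h2 := sqr_ge0 (F1 - F2).
  have h3 := sqr_ge0 (e * a).
  rewrite -(ler_pM2l e0).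
  move: (f x) (f y) F1 F2 FF h1 h2 h3 {le} => X Y F1 F2 FF h1 h2 h3.
  nra.
have P0 : 0 < 2 * a * f x by apply: mulr_gt0 => //; exact: mulr_gt0.
have Q0 := sqr_ge0 (f y); have Q1 : 0 < f y ^+ 2 + 1 by rewrite ltr_wpDl.
(* This [e] satisfies [e * (f y ^+ 2 + 1) = 2 * a * f x], hence contradicts [key]. *)
have := key _ (divr_gt0 P0 Q1).
rewrite [leRHS]mulrAC ler_pdivlMr// mulrDr mulr1; lra.
Qed.

End Pair.
End RotationPairs.

(** * The open set of pairs and the two density statements *)

Section OpenSet.
Variable R : realType.
Implicit Types (A B J : 'M[R]_2) (v : 'cV[R]_2) (s t r : R) (P : 'M[R]_2 * 'M[R]_2).

Lemma rational_multiple_pi_dense t (d : R) : 0 < d ->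
  exists2 s, exists (m : nat) (n : int), (0 < m)%N /\ m%:R * s = pi * n%:~R & `|t - s| < d.
Proof.
move=> d0; have pi0 := pi_gt0 R.
have /rat_in_itvoo[q] : t / pi < (t + d) / pi by rewrite ltr_pM2r ?invr_gt0// ltrDl.
rewrite in_itv/= ltr_pdivrMr// ltr_pdivlMr// => /andP[q1 q2].
exists (ratr q * pi); last by rewrite ltr_norml; apply/andP; split; lra.
exists `|denq q|%N, (numq q); split; first by rewrite absz_gt0 denq_eq0.
have -> : `|denq q|%:R = (denq q)%:~R :> R by rewrite -[in RHS]absz_denq.
by rewrite mulrA /ratr mulrCA divff ?intr_eq0 ?denq_eq0// mulr1 mulrC.
Qed.

(** A nonzero rational [s] works: if [s / pi] were rational, so would be [pi]. *)
Lemma irrational_multiple_pi_dense t (d : R) : 0 < d ->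
  exists2 s, irrational (s / pi) & `|t - s| < d.
Proof.
move=> d0.
have [q q0 qt] : exists2 q : rat, q != 0 & t < ratr q < t + d.
  have /rat_in_itvoo[q] : t < t + d by rewrite ltrDl.
  rewrite in_itv/= => /andP[q1 q2].
  have [q0|q0] := eqVneq q 0; last by exists q => //; apply/andP.
  rewrite q0 rmorph0 in q1 q2.
  have /rat_in_itvoo[p] := q2; rewrite in_itv/= => /andP[p1 p2].
  exists p; last by rewrite (lt_trans q1).
  by apply: contraTneq p1 => ->; rewrite rmorph0 ltxx.
case/andP: qt => q1 q2.
exists (ratr q); last by rewrite ltr_norml; apply/andP; split; lra.
move=> [p _ pE]; apply: (@pi_irrationnal R); exists (q / p) => //.
by rewrite fmorph_div/= pE invf_div mulrC divfK// fmorph_eq0.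
Qed.

(** Four times the determinant minus the squared trace; it is positive exactly when the eigenvalues
    are not real. *)
Definition elliptic_discriminant A : R := - ((A 0 0 - A 1 1) ^+ 2 + 4 * A 0 1 * A 1 0).

Definition frobenius_sqr A : R := A 0 0 ^+ 2 + A 0 1 ^+ 2 + (A 1 0 ^+ 2 + A 1 1 ^+ 2).

(* If [P.1 = r *: rotation J t], then [elliptic_discriminant P.1] equals
   [4 r^2 sin^2 t] and [P.1 1 0 - P.1 0 1] is [r sin t] times the trace
   [J 1 0 - J 0 1] of [qform J], so that the last inequality makes
   [2 * gauge J (P.2 *m v)] at most [r * gauge J v]. *)
Definition dominated_pairs : set ('M[R]_2 * 'M[R]_2) :=
  [set P : 'M[R]_2 * 'M[R]_2 | [/\ 0 < P.1 1 0, 0 < elliptic_discriminant P.1 &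
    16 * (P.1 1 0 - P.1 0 1) ^+ 2 * frobenius_sqr P.2 <
    elliptic_discriminant P.1 * (P.1 0 0 * P.1 1 1 - P.1 0 1 * P.1 1 0)]].

Lemma dominated_pairs_open : open dominated_pairs.
Proof.
have c1 i j : continuous (fun P : 'M[R]_2 * 'M[R]_2 => P.1 i j).
  move=> P; apply: (@continuous_comp _ _ _ fst (fun A : 'M[R]_2 => A i j)).
    exact: cvg_fst.
  exact: coord_continuous.
have c2 i j : continuous (fun P : 'M[R]_2 * 'M[R]_2 => P.2 i j).
  move=> P; apply: (@continuous_comp _ _ _ snd (fun A : 'M[R]_2 => A i j)).
    exact: cvg_snd.
  exact: coord_continuous.
have cA (f g : 'M[R]_2 * 'M[R]_2 -> R) : continuous f -> continuous g ->
    continuous (fun P => f P + g P).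
  by move=> cf cg P; apply: (@continuousD _ _ _ f g); [exact: cf|exact: cg].
have cN (f : 'M[R]_2 * 'M[R]_2 -> R) : continuous f -> continuous (fun P => - f P).
  by move=> cf P; apply: (@continuousN _ _ _ f); exact: cf.
have cM (f g : 'M[R]_2 * 'M[R]_2 -> R) : continuous f -> continuous g ->
    continuous (fun P => f P * g P).
  by move=> cf cg P; apply: (@continuousM _ _ f g); [exact: cf|exact: cg].
have cX (f : 'M[R]_2 * 'M[R]_2 -> R) : continuous f -> continuous (fun P => f P ^+ 2).
  by move=> cf; apply: (cM).
have cc (a : R) : continuous (fun _ : 'M[R]_2 * 'M[R]_2 => a) by exact: cst_continuous.
have cD : continuous (fun P : 'M[R]_2 * 'M[R]_2 => elliptic_discriminant P.1).
  by apply: (cN); apply: (cA); [apply: (cX); apply: (cA); [|apply: (cN)] | apply: (cM); [apply: (cM)|]].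
have op (f : 'M[R]_2 * 'M[R]_2 -> R) : continuous f -> open [set P : 'M[R]_2 * 'M[R]_2 | 0 < f P].
  by move=> cf; apply: (@open_comp _ _ f [set x | x > 0]) => // x _; exact: cf.
pose h (P : 'M[R]_2 * 'M[R]_2) := elliptic_discriminant P.1 * (P.1 0 0 * P.1 1 1 - P.1 0 1 * P.1 1 0) -
  16 * (P.1 1 0 - P.1 0 1) ^+ 2 * frobenius_sqr P.2.
have ch : continuous h.
  apply: (cA); first apply: (cM) => //; first by apply: (cA); [|apply: (cN)]; apply: (cM).
  apply: (cN); apply: (cM); first by apply: (cM) => //; apply: (cX); apply: (cA) => //; exact: cN.
  by apply: (cA); apply: (cA); exact: cX.
have -> : dominated_pairs = [set P : 'M[R]_2 * 'M[R]_2 | 0 < P.1 1 0] `&`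
   [set P : 'M[R]_2 * 'M[R]_2 | 0 < elliptic_discriminant P.1] `&` [set P | 0 < h P].
  apply/seteqP; split=> P.
    by move=> [p1 p2 p3]; split; [split|] => //=; rewrite subr_gt0.
  by move=> [[p1 p2]]; rewrite /= subr_gt0.
by apply: openI; [apply: openI|]; apply: op.
Qed.

Lemma dominated_pairs_nonempty : dominated_pairs !=set0.
Proof.
exists (\matrix_(i, j) (if i == j then 0 else if i == 0 then -1 else 1), 0).
rewrite /dominated_pairs /elliptic_discriminant /frobenius_sqr /= !mxE/=.
split; lra.
Qed.

Lemma sqr_mulmx_le B v :
  (B *m v) 0 0 ^+ 2 + (B *m v) 1 0 ^+ 2 <=
  frobenius_sqr B * (v 0 0 ^+ 2 + v 1 0 ^+ 2).
Proof.
rewrite !mulmx_col2 -subr_ge0.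
have -> : frobenius_sqr B * (v 0 0 ^+ 2 + v 1 0 ^+ 2) -
  ((B 0 0 * v 0 0 + B 0 1 * v 1 0) ^+ 2 + (B 1 0 * v 0 0 + B 1 1 * v 1 0) ^+ 2) =
  (B 0 0 * v 1 0 - B 0 1 * v 0 0) ^+ 2 + (B 1 0 * v 1 0 - B 1 1 * v 0 0) ^+ 2.
  by rewrite /frobenius_sqr; ring.
by rewrite addr_ge0 ?sqr_ge0.
Qed.

(** The eigenvalues of [A] are [h + i w] and [h - i w], with modulus [r] and argument [t] up to
    sign. By Cayley-Hamilton [(A - h) / w] squares to -1. *)
Lemma dominated_pairs_rotation A B : dominated_pairs (A, B) ->
  exists J r t, [/\ complex_structure J, 0 < r, A = r *: rotation J t &
    forall v, 4 * qform J (B *m v) <= r ^+ 2 * qform J v].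
Proof.
move=> [/= k0 D0 small].
set D := elliptic_discriminant A in D0 small.
pose w := Num.sqrt D / 2; pose h := (A 0 0 + A 1 1) / 2.
have w0 : 0 < w by rewrite divr_gt0 ?sqrtr_gt0.
have w2 : w ^+ 2 = D / 4 by rewrite expr_div_n sqr_sqrtr ?(ltW D0)//; field.
have r20 : 0 < h ^+ 2 + w ^+ 2 by rewrite ltr_wpDl ?sqr_ge0 ?exprn_gt0.
pose r := Num.sqrt (h ^+ 2 + w ^+ 2); have r0 : 0 < r by rewrite sqrtr_gt0.
have rhw : r ^+ 2 = h ^+ 2 + w ^+ 2 by rewrite sqr_sqrtr ?(ltW r20).
have r2 : r ^+ 2 = A 0 0 * A 1 1 - A 0 1 * A 1 0.
  by rewrite rhw w2 /h /D /elliptic_discriminant; field.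
pose J : 'M[R]_2 := w^-1 *: (A - h%:M).
have [t [ct st]] : exists t, h / r = cos t /\ w / r = sin t.
  apply: polar_angle; rewrite -[RHS](divff (lt0r_neq0 r20)) -{2}rhw; field.
  exact: lt0r_neq0.
have hJ : complex_structure J.
  split; last by rewrite !mxE/= mulr0n subr0 mulr_gt0 ?invr_gt0.
  have DE : w^-1 ^+ 2 * ((A 0 0 - A 1 1) ^+ 2 / 4 + A 0 1 * A 1 0) = -1.
    apply: (@mulfI _ (w ^+ 2)); first by rewrite expf_neq0 ?gt_eqF.
    by rewrite mulrA -exprMn divff ?gt_eqF// expr1n mul1r w2 /D /elliptic_discriminant; field.
  apply: mat2P; rewrite mulmx2E !mxE/= ?mulr1n ?mulr0n -?DE ?oppr0 /h; field; exact: lt0r_neq0.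
exists J, r, t; split => //.
  apply/matrixP => i j; rewrite /rotation -ct -st !mxE; case: (i == j);
    rewrite ?mulr1n ?mulr0n; field; by rewrite ?(gt_eqF r0) ?(gt_eqF w0).
move=> v; have T0 := qform_trace_gt0 hJ.
set T := J 1 0 - J 0 1 in T0.
have TE : T = (A 1 0 - A 0 1) / w.
  by rewrite /T !mxE/= !mulr0n !subr0 -mulrBr mulrC.
(* Passing from [qform J] to the Euclidean norm and back costs a factor [T] each way. As
   [T = (A 1 0 - A 0 1) / w] and [w ^+ 2 = D / 4], the resulting condition is the last inequality of
   [dominated_pairs]. *)
apply: (@le_trans _ _ (4 * (T * (frobenius_sqr B * (T * qform J v))))).
  rewrite ler_pM2l//; apply: le_trans (qform_le _ hJ) _.
  rewrite ler_pM2l//; apply: le_trans (sqr_mulmx_le _ _) _.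
  rewrite ler_wpM2l ?le_qform//.
  by rewrite !addr_ge0 ?sqr_ge0.
have -> : 4 * (T * (frobenius_sqr B * (T * qform J v))) =
  (4 * T ^+ 2 * frobenius_sqr B) * qform J v by ring.
rewrite ler_wpM2r ?qform_ge0// TE expr_div_n w2 r2.
rewrite -(ler_pM2l D0); apply: le_trans (ltW small).
rewrite le_eqVlt; apply/orP; left; apply/eqP; clearbody D; field; exact: lt0r_neq0.
Qed.

(** Common to both density claims: with [J], [r] and [B] fixed, the pair depends continuously on the
    angle, and the smallness of [B] does not involve the angle. *)
Lemma dominated_pairs_dense (S : set ('M[R]_2 * 'M[R]_2)) (X : set R) :
  (forall t d, 0 < d -> exists2 s, X s & `|t - s| < d) ->
  (forall J B r s, complex_structure J -> 0 < r ->
    (forall v, 4 * qform J (B *m v) <= r ^+ 2 * qform J v) -> X s ->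
    S (r *: rotation J s, B)) ->
  dense_in [set P | dominated_pairs P /\ S P] dominated_pairs.
Proof.
move=> Xd XS; split=> [P []//|[A B] PV U nU].
have [J [r [t [hJ r0 AE small]]]] := dominated_pairs_rotation PV.
have crot : r *: rotation J s @[s --> t] --> r *: rotation J t.
  apply: cvgZl_tmp; apply: cvgD; last by apply: cvgZr_tmp; exact: continuous_sin.
  rewrite -scalemx1; under eq_fun do rewrite -scalemx1.
  by apply: cvgZr_tmp; exact: continuous_cos.
have cphi : (fun s => (r *: rotation J s, B)) @ t --> (A, B).
  by rewrite AE; exact: (cvg_pair crot (cvg_cst B)).
have /nbhs_ballP[d /= d0 sd] :
    nbhs t ((fun s => (r *: rotation J s, B)) @^-1` (U `&` dominated_pairs)).
  exact: (cphi _ (filterI nU (open_nbhs_nbhs (conj dominated_pairs_open PV)))).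
have [s Xs ts] := Xd t d d0; have [Us Vs] := sd s ts.
by exists (r *: rotation J s, B); split=> //; split=> //; exact: XS.
Qed.

End OpenSet.

Theorem theorem4p1 (R : realType) :
  exists V : set ('M[R]_2 * 'M[R]_2),
    [/\ open V, V !=set0,
        dense_in [set A | V A /\ has_unique_barabanov_norm [set A.1; A.2]] V
      & dense_in [set A | V A /\ ~ has_unique_barabanov_norm [set A.1; A.2]] V].
Proof.
exists (@dominated_pairs R); split.
- exact: dominated_pairs_open.
- exact: dominated_pairs_nonempty.
- apply: (dominated_pairs_dense (@irrational_multiple_pi_dense R)).
  by move=> J B r s hJ r0 small; exact: irrational_pair_unique.
- apply: (dominated_pairs_dense (@rational_multiple_pi_dense R)).
  move=> J B r s hJ r0 small [m [n [m0 mn]]].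
  exact: rational_pair_not_unique mn.
Qed.
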